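(* Let $F\colon\mathcal C\to\mathcal D$ be a perfect tensor functor between finite tensor categories. (i) If $F$ is $\otimes$-Frobenius, then $F$ is Frobenius with respect to any $\mathcal D$-module category $\mathcal M$. (ii) If $F$ is Frobenius with respect to the regular $\mathcal D$-module category $\mathcal D$, then $F$ is Frobenius.
   Context: Work over an algebraically closed field $\Bbbk$. A finite tensor category is a finite $\Bbbk$-linear abelian rigid monoidal category with bilinear tensor product and $\mathrm{End}(\mathbb 1)\cong\Bbbk$; a tensor functor is an exact $\Bbbk$-linear strong monoidal functor. $F^{\mathrm{la}},F^{\mathrm{ra}}$ are adjoints and $F^{\mathrm{rra}}=(F^{\mathrm{ra}})^{\mathrm{ra}}$. $F$ is perfect if $F^{\mathrm{ra}}$ is exact (then $F^{\mathrm{rra}}$ exists), and Frobenius if $F^{\mathrm{la}}\cong F^{\mathrm{ra}}$ as $\Bbbk$-linear functors. Let ${}_F\mathcal D_F$ be $\mathcal D$ as a $\mathcal C$-bimodule category via $F(c)\otimes d\otimes F(c')$; $F\colon\mathcal C\to{}_F\mathcal D_F$ and its iterated adjoints are $\mathcal C$-bimodule functors. $F$ is $\otimes$-Frobenius if $F^{\mathrm{la}}\cong F^{\mathrm{ra}}$ as $\mathcal C$-bimodule functors. A $\mathcal D$-module category is a finite $\Bbbk$-linear category with a $\mathcal D$-action exact in each variable; ${}_F\mathcal M$ is $\mathcal M$ with $\mathcal C$-action $c\triangleright^Fm=F(c)\triangleright m$. The relative modular object $\chi_F:=F^{\mathrm{rra}}(\mathbb 1)\in\mathcal D$ carries the half-braiding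 $\sigma_c\colon\chi_F\otimes F(c)\cong F^{\mathrm{rra}}(c)\cong F(c)\otimes\chi_F$ from the bimodule structure of $F^{\mathrm{rra}}$, making $\chi_F\triangleright-\colon{}_F\mathcal M\to{}_F\mathcal M$ a $\mathcal C$-module functor via $\sigma_c\triangleright\mathrm{id}$. $F$ is Frobenius with respect to $\mathcal M$ if $\chi_F\triangleright-\cong\mathrm{id}_{{}_F\mathcal M}$ as $\mathcal C$-module functors. *)

(* Defs.v *)
From HB Require Import structures.
From mathcomp Require Import all_boot all_algebra.

Set Implicit Arguments.
Unset Strict Implicit.
Unset Printing Implicit Defensive.

Import GRing.Theory.
Local Open Scope ring_scope.

Declare Scope cat_scope.
Delimit Scope cat_scope with cat.
Local Open Scope cat_scope.

Reserved Notation "g ∘ f" (at level 40, left associativity).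

Record lincat (k : fieldType) := LinCat {
  obj :> Type;
  hom : obj -> obj -> lmodType k;
  idm : forall x, hom x x;
  comp : forall x y z, hom y z -> hom x y -> hom x z;
  comp1m : forall x y (f : hom x y), comp (idm y) f = f;
  compm1 : forall x y (f : hom x y), comp f (idm x) = f;
  compA : forall x y z w (h : hom z w) (g : hom y z) (f : hom x y),
    comp h (comp g f) = comp (comp h g) f;
  comp_linl : forall x y z (f : hom x y), linear (fun g : hom y z => comp g f);
  comp_linr : forall x y z (g : hom y z), linear (fun f : hom x y => comp g f)
}.
Arguments hom {k l} x y.
Arguments idm {k l} x.
Arguments comp {k l x y z} g f.

Notation "g ∘ f" := (comp g f) : cat_scope.

Record iso (k : fieldType) (C : lincat k) (x y : C) := Iso {
  fwd :> hom x y;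
  bwd : hom y x;
  fwdK : bwd ∘ fwd = idm x;
  bwdK : fwd ∘ bwd = idm y
}.
Arguments bwd {k C x y} i.
Arguments fwd {k C x y} i.

Section Abelian.
Variables (k : fieldType) (C : lincat k).
Implicit Types x y z w : C.

Definition is_iso x y (f : hom x y) :=
  exists g : hom y x, g ∘ f = idm x /\ f ∘ g = idm y.

Definition mono x y (f : hom x y) :=
  forall w (u v : hom w x), f ∘ u = f ∘ v -> u = v.

Definition epi x y (f : hom x y) :=
  forall w (u v : hom y w), u ∘ f = v ∘ f -> u = v.

Definition is_kernel x y z (g : hom y z) (f : hom x y) :=
  g ∘ f = 0 /\
  forall w (h : hom w y), g ∘ h = 0 -> exists! u : hom w x, f ∘ u = h.

Definition is_cokernel x y z (f : hom x y) (g : hom y z) :=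
  g ∘ f = 0 /\
  forall w (h : hom y w), h ∘ f = 0 -> exists! u : hom z w, u ∘ g = h.

Definition short_exact x y z (f : hom x y) (g : hom y z) :=
  is_kernel g f /\ is_cokernel f g.

Definition is_zero x := idm x = 0.

Definition is_biproduct x y s (i : hom x s) (j : hom y s)
    (p : hom s x) (q : hom s y) :=
  [/\ p ∘ i = idm x, q ∘ j = idm y, p ∘ j = 0, q ∘ i = 0
    & i ∘ p + j ∘ q = idm s].

Record abelian : Prop := Abelian {
  ab_zero : exists x, is_zero x;
  ab_biproduct : forall x y, exists s (i : hom x s) (j : hom y s) p q,
    is_biproduct i j p q;
  ab_kernel : forall y z (g : hom y z), exists x (f : hom x y), is_kernel g f;
  ab_cokernel : forall x y (f : hom x y), exists z (g : hom y z),
    is_cokernel f g;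
  ab_mono : forall x y (f : hom x y), mono f ->
    exists z (g : hom y z), is_kernel g f;
  ab_epi : forall y z (g : hom y z), epi g ->
    exists x (f : hom x y), is_cokernel f g
}.

Definition simple x :=
  ~ is_zero x /\ forall y (f : hom y x), mono f -> f = 0 \/ is_iso f.

Inductive finite_length : C -> Prop :=
| finite_length_zero x : is_zero x -> finite_length x
| finite_length_ext x y z (f : hom x y) (g : hom y z) :
    finite_length x -> simple z -> short_exact f g -> finite_length y.

Definition projective p :=
  forall x y (e : hom x y) (f : hom p y), epi e -> exists g : hom p x, e ∘ g = f.

(* Finite abelian k-linear category, in the intrinsic form of
   Etingof-Gelaki-Nikshych-Ostrik: equivalent to modules of finite dimension
   over an algebra of finite dimension. *)
Record finite_cat : Prop := FiniteCat {
  fin_abelian : abelian;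
  fin_hom : forall x y, exists n, inhabited (Vector.axiom n (hom x y));
  fin_length : forall x, finite_length x;
  fin_projective : forall x, exists p (e : hom p x), projective p /\ epi e;
  fin_simple : exists n (s : 'I_n -> C),
    forall x, simple x -> exists i, inhabited (iso x (s i))
}.

End Abelian.

Record functor (k : fieldType) (C D : lincat k) := Functor {
  fobj :> C -> D;
  fmap : forall x y, hom x y -> hom (fobj x) (fobj y);
  fmap1 : forall x, fmap (idm x) = idm (fobj x);
  fmapM : forall x y z (g : hom y z) (f : hom x y),
    fmap (g ∘ f) = fmap g ∘ fmap f;
  fmap_lin : forall x y, linear (@fmap x y)
}.
Arguments fmap {k C D} f {x y} _ : rename.

Definition exact_functor (k : fieldType) (C D : lincat k) (F : functor C D) :=
  forall (x y z : C) (f : hom x y) (g : hom y z),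
    short_exact f g -> short_exact (fmap F f) (fmap F g).

Record natiso (k : fieldType) (C D : lincat k) (F G : functor C D) := NatIso {
  nt :> forall x, iso (F x) (G x);
  nt_nat : forall x y (f : hom x y), nt y ∘ fmap F f = fmap G f ∘ nt x
}.

Definition id_functor (k : fieldType) (C : lincat k) : functor C C.
Proof. by apply: (@Functor k C C id (fun x y f => f)). Defined.

Record adjunction (k : fieldType) (C D : lincat k)
    (L : functor C D) (R : functor D C) := Adjunction {
  adj_unit : forall x, hom x (R (L x));
  adj_counit : forall y, hom (L (R y)) y;
  adj_unit_nat : forall x x' (f : hom x x'),
    adj_unit x' ∘ f = fmap R (fmap L f) ∘ adj_unit x;
  adj_counit_nat : forall y y' (f : hom y y'),
    adj_counit y' ∘ fmap L (fmap R f) = f ∘ adj_counit y;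
  adj_triangle_l : forall x, adj_counit (L x) ∘ fmap L (adj_unit x) = idm (L x);
  adj_triangle_r : forall y, fmap R (adj_counit y) ∘ adj_unit (R y) = idm (R y)
}.
Arguments adj_unit {k C D L R} a x.
Arguments adj_counit {k C D L R} a y.

Record bifunctor (k : fieldType) (A B E : lincat k) := Bifunctor {
  bobj :> A -> B -> E;
  bmap : forall a a' b b', hom a a' -> hom b b' -> hom (bobj a b) (bobj a' b');
  bmap1 : forall a b, bmap (idm a) (idm b) = idm (bobj a b);
  bmapM : forall a a' a'' b b' b''
    (f' : hom a' a'') (f : hom a a') (g' : hom b' b'') (g : hom b b'),
    bmap (f' ∘ f) (g' ∘ g) = bmap f' g' ∘ bmap f g;
  bmap_linl : forall a a' b b' (g : hom b b'),
    linear (fun f : hom a a' => bmap f g);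
  bmap_linr : forall a a' b b' (f : hom a a'),
    linear (fun g : hom b b' => bmap f g)
}.
Arguments bmap {k A B E} b {a a' b0 b'} _ _ : rename.

Section Partial.
Variables (k : fieldType) (A B E : lincat k) (T : bifunctor A B E).

Definition bifix_l (a : A) : functor B E.
Proof.
apply: (@Functor k B E (T a) (fun x y g => bmap T (idm a) g)).
- by move=> x; rewrite bmap1.
- by move=> x y z g f; rewrite -bmapM comp1m.
- by move=> x y; apply: bmap_linr.
Defined.

Definition bifix_r (b : B) : functor A E.
Proof.
apply: (@Functor k A E (T^~ b) (fun x y f => bmap T f (idm b))).
- by move=> x; rewrite bmap1.
- by move=> x y z g f; rewrite -bmapM comp1m.
- by move=> x y; apply: bmap_linl.
Defined.

End Partial.

Section Calculus.
Variables (k : fieldType) (C : lincat k).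
Implicit Types x y z w : C.

Lemma reassoc x y z w (b : hom z w) (a : hom y z) (c : hom y w) :
  b ∘ a = c -> forall r : hom x y, b ∘ (a ∘ r) = c ∘ r.
Proof. by move=> <- r; rewrite compA. Qed.

Lemma fwdKr x y z (i : iso y z) (r : hom x y) : bwd i ∘ (fwd i ∘ r) = r.
Proof. by rewrite compA fwdK comp1m. Qed.

Lemma bwdKr x y z (i : iso y z) (r : hom x z) : fwd i ∘ (bwd i ∘ r) = r.
Proof. by rewrite compA bwdK comp1m. Qed.

Lemma iso_injl x y z (i : iso y z) (f g : hom x y) :
  fwd i ∘ f = fwd i ∘ g -> f = g.
Proof. by move=> e; rewrite -(fwdKr i f) e fwdKr. Qed.

Lemma iso_injr x y z (i : iso x y) (f g : hom y z) :
  f ∘ fwd i = g ∘ fwd i -> f = g.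
Proof. by move=> e; rewrite -(compm1 f) -(bwdK i) compA e -compA bwdK compm1. Qed.

Lemma iso_bwd_eq x y (i j : iso x y) : fwd i = fwd j -> bwd i = bwd j.
Proof. by move=> e; apply: (iso_injl (i := i)); rewrite bwdK e bwdK. Qed.

Definition iso_id x : iso x x.
Proof. by exists (idm x) (idm x); rewrite comp1m. Defined.

Definition iso_inv x y (i : iso x y) : iso y x.
Proof. by exists (bwd i) (fwd i); [apply: bwdK | apply: fwdK]. Defined.

Definition iso_comp x y z (j : iso y z) (i : iso x y) : iso x z.
Proof.
exists (fwd j ∘ fwd i) (bwd i ∘ bwd j); rewrite -compA.
- by rewrite fwdKr fwdK.
- by rewrite bwdKr bwdK.
Defined.

End Calculus.

Definition iso_fmap (k : fieldType) (C D : lincat k) (F : functor C D)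
  (x y : C) (i : iso x y) : iso (F x) (F y).
Proof.
by exists (fmap F (fwd i)) (fmap F (bwd i)); rewrite -fmapM (fwdK, bwdK) fmap1.
Defined.

Definition iso_bmap (k : fieldType) (A B E : lincat k) (T : bifunctor A B E)
  (a a' : A) (b b' : B) (i : iso a a') (j : iso b b') : iso (T a b) (T a' b').
Proof.
by exists (bmap T (fwd i) (fwd j)) (bmap T (bwd i) (bwd j));
  rewrite -bmapM ?fwdK ?bwdK bmap1.
Defined.

Record moncat (k : fieldType) := MonCat {
  mcat :> lincat k;
  tens : bifunctor mcat mcat mcat;
  one : mcat;
  assoc : forall x y z, iso (tens (tens x y) z) (tens x (tens y z));
  lunit : forall x, iso (tens one x) x;
  runit : forall x, iso (tens x one) x;
  assoc_nat : forall x x' y y' z z'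
    (f : hom x x') (g : hom y y') (h : hom z z'),
    assoc x' y' z' ∘ bmap tens (bmap tens f g) h =
    bmap tens f (bmap tens g h) ∘ assoc x y z;
  lunit_nat : forall x x' (f : hom x x'),
    lunit x' ∘ bmap tens (idm one) f = f ∘ lunit x;
  runit_nat : forall x x' (f : hom x x'),
    runit x' ∘ bmap tens f (idm one) = f ∘ runit x;
  pentagon : forall x y z w,
    assoc x y (tens z w) ∘ assoc (tens x y) z w =
    bmap tens (idm x) (assoc y z w) ∘ assoc x (tens y z) w
      ∘ bmap tens (assoc x y z) (idm w);
  triangle : forall x y,
    bmap tens (idm x) (lunit y) ∘ assoc x one y =
    bmap tens (runit x) (idm y)
}.
Arguments tens {k m}.
Arguments one {k m}.
Arguments assoc {k m} x y z.
Arguments lunit {k m} x.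
Arguments runit {k m} x.

Notation "x ⊗ y" := (bobj tens x y) (at level 35, right associativity) : cat_scope.
Notation "f ⊠ g" := (bmap tens f g) (at level 35, right associativity) : cat_scope.
Definition swap_bifunctor (k : fieldType) (A B E : lincat k)
  (T : bifunctor A B E) : bifunctor B A E.
Proof.
apply: (@Bifunctor k B A E (fun b a => T a b)
          (fun b b' a a' g f => bmap T f g)).
- by move=> b a; apply: bmap1.
- by move=> *; apply: bmapM.
- by move=> *; apply: bmap_linr.
- by move=> *; apply: bmap_linl.
Defined.

(* The category C with the reversed tensor product x ⊗' y = y ⊗ x. *)
Definition moncat_rev (k : fieldType) (C : moncat k) : moncat k.
Proof.
apply: (@MonCat k C (swap_bifunctor tens) one
  (fun x y z => iso_inv (assoc z y x)) (fun x => runit x) (fun x => lunit x)).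
- move=> x x' y y' z z' f g h /=; apply: (iso_injl (i := assoc z' y' x')).
  rewrite bwdKr compA assoc_nat -compA.
  by rewrite bwdK compm1.
- by move=> x x' f; apply: runit_nat.
- by move=> x x' f; apply: lunit_nat.
- move=> x y z w /=.
  have /iso_bwd_eq := pentagon w z y x
    : fwd (iso_comp (assoc w z (y ⊗ x)) (assoc (w ⊗ z) y x)) =
      fwd (iso_comp (iso_comp (iso_bmap tens (iso_id w) (assoc z y x))
        (assoc w (z ⊗ y) x)) (iso_bmap tens (assoc w z y) (iso_id x))).
  by rewrite /= => ->; rewrite compA.
- move=> x y /=.
  apply: (iso_injr (i := assoc y one x)).
  by rewrite -compA fwdK compm1 triangle.
Defined.

Record action (k : fieldType) (C : moncat k) (M : lincat k) := Action {
  act :> bifunctor C M M;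
  actA : forall c d m, iso (act (c ⊗ d) m) (act c (act d m));
  act1 : forall m, iso (act one m) m;
  actA_nat : forall c c' d d' m m'
    (f : hom c c') (g : hom d d') (h : hom m m'),
    actA c' d' m' ∘ bmap act (f ⊠ g) h =
    bmap act f (bmap act g h) ∘ actA c d m;
  act1_nat : forall m m' (h : hom m m'),
    act1 m' ∘ bmap act (idm one) h = h ∘ act1 m;
  act_pentagon : forall c d e m,
    actA c d (act e m) ∘ actA (c ⊗ d) e m =
    bmap act (idm c) (actA d e m) ∘ actA c (d ⊗ e) m
      ∘ bmap act (assoc c d e) (idm m);
  act_triangle : forall c m,
    bmap act (idm c) (act1 m) ∘ actA c one m = bmap act (runit c) (idm m)
}.
Arguments actA {k C M} a c d m.
Arguments act1 {k C M} a m.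

Record modstr (k : fieldType) (C : moncat k) (M N : lincat k)
    (aM : action C M) (aN : action C N) (G : functor M N) := ModStr {
  ms :> forall c m, iso (G (aM c m)) (aN c (G m));
  ms_nat : forall c c' m m' (f : hom c c') (h : hom m m'),
    ms c' m' ∘ fmap G (bmap aM f h) = bmap aN f (fmap G h) ∘ ms c m;
  ms_assoc : forall c d m,
    actA aN c d (G m) ∘ ms (c ⊗ d) m =
    bmap aN (idm c) (ms d m) ∘ ms c (aM d m) ∘ fmap G (actA aM c d m);
  ms_unit : forall m, act1 aN (G m) ∘ ms one m = fmap G (act1 aM m)
}.

Definition id_modstr (k : fieldType) (C : moncat k) (M : lincat k)
  (a : action C M) : modstr a a (id_functor M).
Proof.
apply: (@ModStr k C M M a a (id_functor M) (fun c m => iso_id (a c m))).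
- by move=> *; rewrite /= comp1m compm1.
- by move=> *; rewrite /= bmap1 !comp1m compm1.
- by move=> *; rewrite /= compm1.
Defined.

Definition is_modtrans (k : fieldType) (C : moncat k) (M N : lincat k)
    (aM : action C M) (aN : action C N) (G H : functor M N)
    (sG : modstr aM aN G) (sH : modstr aM aN H)
    (t : forall m, hom (G m) (H m)) :=
  forall c m, sH c m ∘ t (aM c m) = bmap aN (idm c) (t m) ∘ sG c m.

Definition mod_isomorphic (k : fieldType) (C : moncat k) (M N : lincat k)
    (aM : action C M) (aN : action C N) (G H : functor M N)
    (sG : modstr aM aN G) (sH : modstr aM aN H) :=
  exists t : natiso G H, is_modtrans sG sH (fun m => t m).

(* The unit and the counit of L -| R are C-module transformations
   Id -> R L and L R -> Id. *)
Definition is_modadj (k : fieldType) (C : moncat k) (M N : lincat k)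
    (aM : action C M) (aN : action C N) (L : functor M N) (R : functor N M)
    (sL : modstr aM aN L) (sR : modstr aN aM R) (A : adjunction L R) :=
  (forall c m,
    sR c (L m) ∘ fmap R (sL c m) ∘ adj_unit A (aM c m) =
    bmap aM (idm c) (adj_unit A m)) /\
  (forall c n,
    bmap aN (idm c) (adj_counit A n) ∘ sL c (R n) ∘ fmap L (sR c n) =
    adj_counit A (aN c n)).

Definition regular_action (k : fieldType) (C : moncat k) : action C C :=
  @Action k C C tens assoc lunit (@assoc_nat k C) (@lunit_nat k C)
    (@pentagon k C) (@triangle k C).

Section Exactness.
Variable k : fieldType.

Lemma fmap0 (C D : lincat k) (F : functor C D) (x y : C) :
  fmap F (0 : hom x y) = 0.
Proof. by have := fmap_lin F (-1) (0 : hom x y) 0; rewrite !scaleN1r !addNr. Qed.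

Lemma comp0m (C : lincat k) (x y z : C) (f : hom x y) : (0 : hom y z) ∘ f = 0.
Proof. by have := comp_linl f (-1) (0 : hom y z) 0; rewrite !scaleN1r !addNr. Qed.

Lemma compm0 (C : lincat k) (x y z : C) (g : hom y z) : g ∘ (0 : hom x y) = 0.
Proof. by have := comp_linr g (-1) (0 : hom x y) 0; rewrite !scaleN1r !addNr. Qed.

Lemma right_adjoint_kernel (C D : lincat k) (L : functor C D) (R : functor D C)
  (A : adjunction L R) (x y z : D) (g : hom y z) (f : hom x y) :
  is_kernel g f -> is_kernel (fmap R g) (fmap R f).
Proof.
case=> gf0 ker; split=> [|w h gh0]; first by rewrite -fmapM gf0 fmap0.
have [|u [fu uniq_u]] := ker _ (adj_counit A y ∘ fmap L h).
  by rewrite compA -adj_counit_nat -compA -fmapM gh0 fmap0 compm0.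
exists (fmap R u ∘ adj_unit A w); split.
  by rewrite compA -fmapM fu fmapM -compA -adj_unit_nat compA adj_triangle_r
     comp1m.
move=> v fv; have -> : u = adj_counit A x ∘ fmap L v.
  by apply: uniq_u; rewrite compA -adj_counit_nat -compA -fmapM fv.
by rewrite fmapM -compA -adj_unit_nat compA adj_triangle_r comp1m.
Qed.

Lemma left_adjoint_cokernel (C D : lincat k) (L : functor C D) (R : functor D C)
  (A : adjunction L R) (x y z : C) (f : hom x y) (g : hom y z) :
  is_cokernel f g -> is_cokernel (fmap L f) (fmap L g).
Proof.
case=> gf0 coker; split=> [|w h hf0]; first by rewrite -fmapM gf0 fmap0.
have [|u [ug uniq_u]] := coker _ (fmap R h ∘ adj_unit A y).
  by rewrite -compA adj_unit_nat compA -fmapM hf0 fmap0 comp0m.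
exists (adj_counit A w ∘ fmap L u); split.
  by rewrite -compA -fmapM ug fmapM compA adj_counit_nat -compA adj_triangle_l
     compm1.
move=> v vg; have -> : u = fmap R v ∘ adj_unit A z.
  by apply: uniq_u; rewrite -compA adj_unit_nat compA -fmapM vg.
by rewrite fmapM compA adj_counit_nat -compA adj_triangle_l compm1.
Qed.

Variable C : moncat k.

(* y is a left dual of x. *)
Definition is_dual (y x : C) :=
  exists (ev : hom (y ⊗ x) one) (coev : hom one (x ⊗ y)),
    runit x ∘ (idm x ⊠ ev) ∘ assoc x y x ∘ (coev ⊠ idm x) ∘ bwd (lunit x)
      = idm x /\
    lunit y ∘ (ev ⊠ idm y) ∘ bwd (assoc y x y) ∘ (idm y ⊠ coev)
      ∘ bwd (runit y) = idm y.

Definition rigid :=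
  (forall x, exists y, is_dual y x) /\ (forall x, exists z, is_dual x z).

Variables (M : lincat k) (a : action C M).

(* Kelly's redundancy of the left unit triangle. *)
Lemma act_lunit c m :
  act1 a (a c m) ∘ actA a one c m = bmap a (lunit c) (idm m).
Proof.
have faithful (n n' : M) (f g : hom n n') :
    bmap a (idm one) f = bmap a (idm one) g -> f = g.
  by move=> e; apply: (iso_injr (i := act1 a n)); rewrite -!act1_nat e.
apply: faithful; apply: (iso_injr (i := iso_comp (actA a one (one ⊗ c) m)
  (iso_bmap a (assoc one one c) (iso_id m)))).
rewrite /= -{1}(comp1m (idm one)) bmapM -!compA.
have := act_pentagon a one one c m; rewrite -!compA => <-.
rewrite compA act_triangle -{1}(bmap1 a c m) -actA_nat.
rewrite (compA _ (actA _ _ _ _)) -actA_nat -compA -bmapM.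
by rewrite triangle comp1m.
Qed.

Lemma actA_natV c c' d d' m m' (f : hom c c') (g : hom d d') (h : hom m m') :
  bwd (actA a c' d' m') ∘ bmap a f (bmap a g h) =
  bmap a (f ⊠ g) h ∘ bwd (actA a c d m).
Proof.
apply: (iso_injl (i := actA a c' d' m')); rewrite bwdKr compA actA_nat -compA.
by rewrite bwdK compm1.
Qed.

Lemma act1_natV m m' (h : hom m m') :
  bwd (act1 a m') ∘ h = bmap a (idm one) h ∘ bwd (act1 a m).
Proof.
apply: (iso_injl (i := act1 a m')); rewrite bwdKr compA act1_nat -compA.
by rewrite bwdK compm1.
Qed.

Lemma bmap_split c c' m m' (f : hom c c') (g : hom m m') :
  bmap a f g = bmap a f (idm m') ∘ bmap a (idm c) g.
Proof. by rewrite -bmapM comp1m compm1. Qed.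

Lemma bmap_swap c c' m m' (f : hom c c') (g : hom m m') :
  bmap a f (idm m') ∘ bmap a (idm c) g = bmap a (idm c') g ∘ bmap a f (idm m).
Proof. by rewrite -!bmapM !comp1m !compm1. Qed.

Lemma bmapr c m m' m'' (g : hom m' m'') (h : hom m m') :
  bmap a (idm c) (g ∘ h) = bmap a (idm c) g ∘ bmap a (idm c) h.
Proof. by rewrite -bmapM comp1m. Qed.

Lemma bmapl c c' c'' m (g : hom c' c'') (h : hom c c') :
  bmap a (g ∘ h) (idm m) = bmap a g (idm m) ∘ bmap a h (idm m).
Proof. by rewrite -bmapM comp1m. Qed.

Lemma pentagon_V1 c d e m :
  bwd (actA a c d (a e m)) ∘ bmap a (idm c) (actA a d e m) =
  actA a (c ⊗ d) e m ∘ bmap a (bwd (assoc c d e)) (idm m)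
    ∘ bwd (actA a c (d ⊗ e) m).
Proof.
apply: (iso_injl (i := actA a c d (a e m))); rewrite bwdKr !compA.
rewrite act_pentagon -!compA.
rewrite (reassoc (esym (bmapl _ _ _))) bwdK bmap1 comp1m.
by rewrite bwdK compm1.
Qed.

Lemma pentagon_V2 c d e m :
  bmap a (idm c) (bwd (actA a d e m)) ∘ actA a c d (a e m) =
  actA a c (d ⊗ e) m ∘ bmap a (assoc c d e) (idm m)
    ∘ bwd (actA a (c ⊗ d) e m).
Proof.
apply: (iso_injr (i := actA a (c ⊗ d) e m)).
rewrite -!compA fwdK compm1 act_pentagon -!compA compA -bmapr fwdK bmap1.
by rewrite comp1m.
Qed.

Definition dual_adjunction (x y : C)
    (ev : hom (y ⊗ x) one) (coev : hom one (x ⊗ y)) :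
  runit x ∘ (idm x ⊠ ev) ∘ assoc x y x ∘ (coev ⊠ idm x) ∘ bwd (lunit x)
    = idm x ->
  lunit y ∘ (ev ⊠ idm y) ∘ bwd (assoc y x y) ∘ (idm y ⊠ coev)
    ∘ bwd (runit y) = idm y ->
  adjunction (bifix_l a y) (bifix_l a x).
Proof.
move=> zx zy.
apply: (@Adjunction k M M (bifix_l a y) (bifix_l a x)
  (fun m => actA a x y m ∘ bmap a coev (idm m) ∘ bwd (act1 a m))
  (fun m => act1 a m ∘ bmap a ev (idm m) ∘ bwd (actA a y x m))).
- move=> m m' f /=; rewrite -!compA act1_natV (reassoc (bmap_swap _ _)).
  by rewrite (compA _ _ (bmap _ coev _ ∘ _)) -actA_nat bmap1 -!compA.
- move=> m m' f /=; rewrite -!compA actA_natV bmap1.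
  by rewrite (reassoc (bmap_swap _ _)) -!compA (reassoc (act1_nat _ _)) -!compA.
- move=> m /=; rewrite !bmapr -!compA (reassoc (pentagon_V1 _ _ _ _)) -!compA.
  rewrite -(bmap1 a y m) (reassoc (esym (actA_nat _ _ _ _))) -!compA.
  rewrite (reassoc (act_lunit _ _)) (reassoc (actA_natV _ _ _)) -!compA.
  have -> : bwd (actA a y one m) ∘ bmap a (idm y) (bwd (act1 a m)) =
      bmap a (bwd (runit y)) (idm m).
    apply: (iso_injl (i := actA a y one m)); rewrite bwdKr.
    apply: (iso_injl (i := iso_bmap a (iso_id y) (act1 a m))).
    rewrite /= -bmapr bwdK bmap1 compA act_triangle -bmapl bwdK.
    by rewrite bmap1.
  by rewrite -!bmapl !compA zy.
- move=> m /=; rewrite !bmapr -!compA (reassoc (pentagon_V2 _ _ _ _)) -!compA.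
  rewrite -(bmap1 a x m) (reassoc (actA_natV _ _ _)) -!compA.
  rewrite (reassoc (esym (actA_nat _ _ _ _))) -!compA.
  rewrite (reassoc (act_triangle _ _ _)).
  have -> : bwd (actA a one x m) ∘ bwd (act1 a (a x m)) =
      bmap a (bwd (lunit x)) (idm m).
    apply: (iso_injl (i := actA a one x m)); rewrite bwdKr.
    apply: (iso_injl (i := act1 a (a x m))).
    by rewrite bwdK compA act_lunit -bmapl bwdK bmap1.
  by rewrite -!bmapl !compA zx bmap1.
Qed.

Hypothesis C_rigid : rigid.

Lemma rigid_exact x : exact_functor (bifix_l a x).
Proof.
have [[y [ev [coev [zx zy]]]] [z [ev' [coev' [zx' zy']]]]] :=
  (C_rigid.1 x, C_rigid.2 x).
move=> u v w f g [ker coker]; split.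
- exact: right_adjoint_kernel (dual_adjunction zx zy) _ _ _ _ _ ker.
- exact: left_adjoint_cokernel (dual_adjunction zx' zy') _ _ _ _ _ coker.
Qed.

End Exactness.

Lemma rev_rigid (k : fieldType) (C : moncat k) : rigid C -> rigid (moncat_rev C).
Proof.
have dual_rev x y : @is_dual k C y x -> @is_dual k (moncat_rev C) x y.
  move=> [ev [coev [zx zy]]]; exists ev, coev; split=> /=.
  - exact: zy.
  - exact: zx.
move=> [l r]; split=> x.
- by have [z /dual_rev] := r x; exists z.
- by have [y /dual_rev] := l x; exists y.
Qed.

Record fin_tensor_cat (k : fieldType) := FinTensorCat {
  ftc :> moncat k;
  ftc_finite : finite_cat ftc;
  ftc_rigid : rigid ftc;
  (* End(1) = k *)
  ftc_one : bijective (fun c : k => c *: idm (one : ftc))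
}.

Record tensor_functor (k : fieldType) (C D : moncat k) := TensorFunctor {
  tf :> functor C D;
  tfM : forall x y, iso (tf x ⊗ tf y) (tf (x ⊗ y));
  tf1 : iso one (tf one);
  tfM_nat : forall x x' y y' (f : hom x x') (g : hom y y'),
    tfM x' y' ∘ (fmap tf f ⊠ fmap tf g) = fmap tf (f ⊠ g) ∘ tfM x y;
  tf_assoc : forall x y z,
    fmap tf (assoc x y z) ∘ tfM (x ⊗ y) z ∘ (tfM x y ⊠ idm (tf z)) =
    tfM x (y ⊗ z) ∘ (idm (tf x) ⊠ tfM y z) ∘ assoc (tf x) (tf y) (tf z);
  tf_lunit : forall x,
    fmap tf (lunit x) ∘ tfM one x ∘ (tf1 ⊠ idm (tf x)) = lunit (tf x);
  tf_runit : forall x,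
    fmap tf (runit x) ∘ tfM x one ∘ (idm (tf x) ⊠ tf1) = runit (tf x);
  tf_exact : exact_functor tf
}.
Arguments tfM {k C D} t x y.
Arguments tf1 {k C D} t.

Section TensorFunctor.
Variables (k : fieldType) (C D : moncat k) (F : tensor_functor C D).

Lemma tfM_natV x x' y y' (f : hom x x') (g : hom y y') :
  bwd (tfM F x' y') ∘ fmap F (f ⊠ g) = (fmap F f ⊠ fmap F g) ∘ bwd (tfM F x y).
Proof.
apply: (iso_injl (i := tfM F x' y')); rewrite bwdKr compA tfM_nat -compA.
by rewrite bwdK compm1.
Qed.

Lemma tf_assocV x y z :
  (idm (F x) ⊠ bwd (tfM F y z)) ∘ (bwd (tfM F x (y ⊗ z)) ∘ fmap F (assoc x y z)) =
  assoc (F x) (F y) (F z)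
    ∘ ((bwd (tfM F x y) ⊠ idm (F z)) ∘ bwd (tfM F (x ⊗ y) z)).
Proof.
apply: (iso_injl (i := iso_comp (tfM F x (y ⊗ z))
  (iso_bmap tens (iso_id (F x)) (tfM F y z)))) => /=.
rewrite -!compA (reassoc (esym (bmapM _ _ _ _ _))) bwdK comp1m bmap1 comp1m.
rewrite bwdKr; apply: (iso_injr (i := iso_comp (tfM F (x ⊗ y) z)
  (iso_bmap tens (tfM F x y) (iso_id (F z))))) => /=.
rewrite -!compA fwdKr -bmapM fwdK comp1m bmap1 compm1.
by have := tf_assoc F x y z; rewrite -!compA.
Qed.

Lemma tf_runitV x :
  runit (F x) ∘ ((idm (F x) ⊠ bwd (tf1 F)) ∘ bwd (tfM F x one)) =
  fmap F (runit x).
Proof.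
rewrite -tf_runit -!compA (reassoc (esym (bmapM _ _ _ _ _))) bwdK comp1m bmap1.
by rewrite comp1m bwdK compm1.
Qed.

Lemma tf_lunitV x :
  lunit (F x) ∘ ((bwd (tf1 F) ⊠ idm (F x)) ∘ bwd (tfM F one x)) =
  fmap F (lunit x).
Proof.
rewrite -tf_lunit -!compA (reassoc (esym (bmapM _ _ _ _ _))) bwdK comp1m bmap1.
by rewrite comp1m bwdK compm1.
Qed.

Lemma tf_assoc_bwd x y z :
  fmap F (bwd (assoc x y z)) ∘ tfM F x (y ⊗ z) ∘ (idm (F x) ⊠ tfM F y z) =
  tfM F (x ⊗ y) z ∘ (tfM F x y ⊠ idm (F z)) ∘ bwd (assoc (F x) (F y) (F z)).
Proof.
apply: (iso_injr (i := assoc (F x) (F y) (F z))).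
rewrite -[in RHS]compA fwdK compm1.
apply: (iso_injl (i := iso_fmap F (assoc x y z))).
rewrite /= !compA -fmapM bwdK fmap1 comp1m.
exact/esym/tf_assoc.
Qed.

End TensorFunctor.

Definition rev_functor (k : fieldType) (C D : moncat k)
  (F : tensor_functor C D) : tensor_functor (moncat_rev C) (moncat_rev D).
Proof.
apply: (@TensorFunctor k (moncat_rev C) (moncat_rev D) F (fun x y => tfM F y x) (tf1 F)).
- by move=> x x' y y' f g; apply: (tfM_nat F g f).
- by move=> x y z; apply: (tf_assoc_bwd F z y x).
- by move=> x; apply: (tf_runit F x).
- by move=> x; apply: (tf_lunit F x).
- exact: (@tf_exact k C D F).
Defined.

Record modcat (k : fieldType) (D : moncat k) := ModCat {
  mc :> lincat k;
  mc_act : action D mc;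
  mc_finite : finite_cat mc;
  mc_exact_l : forall x, exact_functor (bifix_l mc_act x);
  mc_exact_r : forall m, exact_functor (bifix_r mc_act m)
}.

Definition regular_modcat (k : fieldType) (D : fin_tensor_cat k) : modcat D.
Proof.
apply: (@ModCat k D D (regular_action D) (ftc_finite D)).
- exact: rigid_exact (ftc_rigid D).
- move=> m; exact: (@rigid_exact k (moncat_rev D) D (regular_action (moncat_rev D))
    (rev_rigid (ftc_rigid D)) m).
Defined.

Definition res_bifunctor (k : fieldType) (A A' B E : lincat k)
  (T : bifunctor A' B E) (F : functor A A') : bifunctor A B E.
Proof.
apply: (@Bifunctor k A B E (fun x y => T (F x) y)
  (fun x x' y y' f g => bmap T (fmap F f) g)).
- by move=> x y; rewrite fmap1 bmap1.
- by move=> *; rewrite fmapM bmapM.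
- by move=> x x' y y' g c f f' /=; rewrite fmap_lin bmap_linl.
- by move=> x x' y y' f; apply: bmap_linr.
Defined.

Definition res_action (k : fieldType) (C D : moncat k)
  (F : tensor_functor C D) (M : lincat k) (a : action D M) : action C M.
Proof.
apply: (@Action k C M (res_bifunctor a F)
  (fun c d m => iso_comp (actA a (F c) (F d) m)
     (iso_bmap a (iso_inv (tfM F c d)) (iso_id m)))
  (fun m => iso_comp (act1 a m) (iso_bmap a (iso_inv (tf1 F)) (iso_id m)))).
- move=> c c' d d' m m' f g h /=.
  rewrite compA -actA_nat -!compA -!bmapM comp1m compm1; congr (_ ∘ bmap _ _ _).
  apply: (iso_injl (i := tfM F c' d')); rewrite bwdKr compA tfM_nat -compA.
  by rewrite bwdK compm1.
- move=> m m' h; change (act1 a m' ∘ bmap a (bwd (tf1 F)) (idm m')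
      ∘ bmap a (fmap F (idm one)) h =
    h ∘ (act1 a m ∘ bmap a (bwd (tf1 F)) (idm m))).
  by rewrite compA -act1_nat -!compA -!bmapM fmap1 !comp1m !compm1.
- move=> c d e m /=; rewrite -!compA fmap1 !bmapr -!compA.
  rewrite -{1}(bmap1 a (F e) m) (reassoc (esym (actA_nat _ _ _ _))) -!compA.
  rewrite (reassoc (act_pentagon _ _ _ _ _)) -!compA.
  rewrite (reassoc (esym (actA_nat _ _ _ _))) -!compA -!bmapl.
  by rewrite tf_assocV.
- move=> c m /=; rewrite fmap1 !bmapr -!compA.
  rewrite (reassoc (esym (actA_nat _ _ _ _))) -!compA.
  by rewrite (reassoc (act_triangle _ _ _)) -!bmapl tf_runitV.
Defined.

(* A right C-module category is a module category over moncat_rev C; below, the right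
   translate of m by d is bm_r d m. *)
Record bimodcat (k : fieldType) (C : moncat k) := BimodCat {
  bm :> lincat k;
  bm_l : action C bm;
  bm_r : action (moncat_rev C) bm;
  mid : forall c m d, iso (bm_r d (bm_l c m)) (bm_l c (bm_r d m));
  mid_nat : forall c c' m m' d d' (f : hom c c') (g : hom m m') (h : hom d d'),
    mid c' m' d' ∘ bmap bm_r h (bmap bm_l f g) =
    bmap bm_l f (bmap bm_r h g) ∘ mid c m d;
  mid_pentagon_l : forall c c' m d,
    actA bm_l c c' (bm_r d m) ∘ mid (c ⊗ c') m d =
    bmap bm_l (idm c) (mid c' m d) ∘ mid c (bm_l c' m) d
      ∘ bmap bm_r (idm d) (actA bm_l c c' m);
  mid_pentagon_r : forall (c : C) m (d e : C),
    bmap bm_l (idm c) (actA bm_r e d m) ∘ mid c m (d ⊗ e) =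
    mid c (bm_r d m) e ∘ bmap bm_r (idm e) (mid c m d)
      ∘ actA bm_r e d (bm_l c m);
  mid_unit_l : forall m d,
    act1 bm_l (bm_r d m) ∘ mid one m d = bmap bm_r (idm d) (act1 bm_l m);
  mid_unit_r : forall c m,
    bmap bm_l (idm c) (act1 bm_r m) ∘ mid c m one = act1 bm_r (bm_l c m)
}.
Arguments bm_l {k C} b.
Arguments bm_r {k C} b.
Arguments mid {k C} b c m d.

Definition regular_bimod (k : fieldType) (C : moncat k) : bimodcat C.
Proof.
apply: (@BimodCat k C C (regular_action C) (regular_action (moncat_rev C)) assoc).
- by move=> *; apply: assoc_nat.
- by move=> *; apply: pentagon.
- by move=> c m d e; apply: (pentagon_V2 (regular_action C) c m d e).
- by move=> m d; apply: (act_lunit (regular_action C) m d).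
- move=> c m /=; apply: (iso_injr (i := iso_inv (assoc c m one))).
  rewrite -compA bwdK compm1; apply/esym.
  exact: (act_lunit (regular_action (moncat_rev C)) m c).
Defined.

Definition res_bimod (k : fieldType) (C D : moncat k)
  (F : tensor_functor C D) (B : bimodcat D) : bimodcat C.
Proof.
apply: (@BimodCat k C B (res_action F (bm_l B))
  (res_action (rev_functor F) (bm_r B)) (fun c m d => mid B (F c) m (F d))).
- by move=> *; apply: mid_nat.
- move=> c c' m d /=; rewrite !fmap1 bmapr !compA -mid_pentagon_l -!compA.
  by rewrite mid_nat bmap1.
- move=> c m d e /=; rewrite !fmap1 bmapr -!compA.
  rewrite -{1}(bmap1 (bm_l B) (F c) m) -mid_nat !compA.
  by congr (_ ∘ _); apply: mid_pentagon_r.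
- move=> m d /=; rewrite !fmap1 bmapr -mid_unit_l -!compA.
  by rewrite mid_nat bmap1.
- move=> c m /=; rewrite !fmap1 bmapr -!compA.
  rewrite -(bmap1 (bm_l B) (F c) m) -mid_nat !compA.
  by congr (_ ∘ _); apply: mid_unit_r.
Defined.

Record bimodfun (k : fieldType) (C : moncat k) (M N : bimodcat C) := BimodFun {
  bf :> functor M N;
  bf_l : modstr (bm_l M) (bm_l N) bf;
  bf_r : modstr (bm_r M) (bm_r N) bf;
  bf_mid : forall c m d,
    bmap (bm_l N) (idm c) (bf_r d m) ∘ bf_l c (bm_r M d m)
      ∘ fmap bf (mid M c m d) =
    mid N c (bf m) d ∘ bmap (bm_r N) (idm d) (bf_l c m) ∘ bf_r d (bm_l M c m)
}.
Arguments bf_l {k C M N} b.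
Arguments bf_r {k C M N} b.

Definition bimod_isomorphic (k : fieldType) (C : moncat k) (M N : bimodcat C)
    (G H : bimodfun M N) :=
  exists t : natiso G H, is_modtrans (bf_l G) (bf_l H) (fun m => t m) /\
                         is_modtrans (bf_r G) (bf_r H) (fun m => t m).

(* Adjunction of bimodule functors. The bimodule structure of an adjoint is the
   unique one for which unit and counit are bimodule transformations: its
   constraints are the mates of those of the given functor. *)
Record bimod_adjunction (k : fieldType) (C : moncat k) (M N : bimodcat C)
    (L : bimodfun M N) (R : bimodfun N M) := BimodAdjunction {
  ba :> adjunction L R;
  ba_l : is_modadj (bf_l L) (bf_l R) ba;
  ba_r : is_modadj (bf_r L) (bf_r R) ba
}.

Definition tf_modstr (k : fieldType) (C D : moncat k) (F : tensor_functor C D) :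
  modstr (regular_action C) (res_action F (regular_action D)) F.
Proof.
apply: (@ModStr k C C D (regular_action C)
  (res_action F (regular_action D)) F (fun c m => iso_inv (tfM F c m))).
- by move=> *; apply: tfM_natV.
- by move=> c d m; rewrite /= fmap1 -!compA; apply/esym/tf_assocV.
- by move=> m; rewrite /= -!compA; apply: tf_lunitV.
Defined.

Definition tf_bimodfun (k : fieldType) (C D : moncat k)
  (F : tensor_functor C D) :
  bimodfun (regular_bimod C) (res_bimod F (regular_bimod D)).
Proof.
apply: (@BimodFun k C (regular_bimod C) (res_bimod F (regular_bimod D)) F
  (tf_modstr F) (tf_modstr (rev_functor F))).
by move=> c m d; rewrite /= !fmap1 -!compA; apply: tf_assocV.
Defined.

Record half_braiding (k : fieldType) (C D : moncat k)
    (F : tensor_functor C D) (z : D) := HalfBraiding {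
  hb :> forall c : C, iso (z ⊗ F c) (F c ⊗ z);
  hb_nat : forall c c' (f : hom c c'),
    hb c' ∘ (idm z ⊠ fmap F f) = (fmap F f ⊠ idm z) ∘ hb c;
  hb_tens : forall c d,
    hb (c ⊗ d) ∘ (idm z ⊠ tfM F c d) =
    (tfM F c d ⊠ idm z) ∘ bwd (assoc (F c) (F d) z) ∘ (idm (F c) ⊠ hb d)
      ∘ assoc (F c) z (F d) ∘ (hb c ⊠ idm (F d)) ∘ bwd (assoc z (F c) (F d));
  hb_one :
    hb one ∘ (idm z ⊠ tf1 F) = (tf1 F ⊠ idm z) ∘ bwd (lunit z) ∘ runit z
}.

(* z acts on M as a C-module functor by means of its half-braiding. *)
Definition hb_modstr (k : fieldType) (C D : moncat k)
  (F : tensor_functor C D) (z : D) (s : half_braiding F z)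
  (M : lincat k) (a : action D M) :
  modstr (res_action F a) (res_action F a) (bifix_l a z).
Proof.
apply: (@ModStr k C M M (res_action F a) (res_action F a) (bifix_l a z)
  (fun c m => iso_comp (actA a (F c) z m)
     (iso_comp (iso_bmap a (s c) (iso_id m)) (iso_inv (actA a z (F c) m))))).
- move=> c c' m m' f h /=; rewrite -!compA actA_natV.
  rewrite (reassoc (esym (bmapM _ _ _ _ _))) hb_nat.
  rewrite comp1m -(compm1 h) bmapM -!compA compm1.
  by rewrite (reassoc (actA_nat _ _ _ _)) -!compA.
- move=> c d m /=; rewrite !fmap1 !bmapr -!compA.
  have E : (bwd (tfM F c d) ⊠ idm z) ∘ s (c ⊗ d) =
      bwd (assoc (F c) (F d) z) ∘ ((idm (F c) ⊠ s d) ∘ (assoc (F c) z (F d)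
       ∘ ((s c ⊠ idm (F d)) ∘ (bwd (assoc z (F c) (F d))
       ∘ (idm z ⊠ bwd (tfM F c d)))))).
    apply: (iso_injr (i := iso_bmap tens (iso_id z) (tfM F c d))) => /=.
    rewrite -!compA -bmapM fwdK comp1m bmap1 compm1 hb_tens -!compA.
    by rewrite (reassoc (esym (bmapM _ _ _ _ _))) fwdK comp1m bmap1 comp1m.
  rewrite -{1}(bmap1 a z m) (reassoc (esym (actA_nat _ _ _ _))) -!compA.
  rewrite (reassoc (act_pentagon _ _ _ _ _)) -!compA.
  rewrite (reassoc (esym (bmapl _ _ (_ ⊠ idm z) (fwd (s _))))) E.
  rewrite !bmapl -!compA.
  rewrite -actA_natV.
  rewrite (reassoc (esym (bmapl _ _ _ _))) bwdK bmap1 comp1m.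
  rewrite (reassoc (pentagon_V1 _ _ _ _ _)) -!compA.
  rewrite -(bmap1 a (F d) m) (reassoc (esym (actA_nat _ (s c) _ _))) -!compA.
  rewrite (reassoc (pentagon_V2 _ _ _ _ _)) -!compA fwdKr.
  by rewrite (reassoc (esym (actA_nat _ _ (s d) _))) -!compA.
- move=> m /=; rewrite !bmapr -!compA.
  have E : lunit z ∘ ((bwd (tf1 F) ⊠ idm z) ∘ s one) =
      runit z ∘ (idm z ⊠ bwd (tf1 F)).
    apply: (iso_injr (i := iso_bmap tens (iso_id z) (tf1 F))) => /=.
    rewrite -!compA -bmapM fwdK comp1m bmap1 compm1 hb_one -!compA.
    rewrite (reassoc (esym (bmapM _ _ _ _ _))) fwdK comp1m bmap1 comp1m.
    by rewrite bwdKr.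
  rewrite -{1}(bmap1 a z m) (reassoc (esym (actA_nat _ _ _ _))) -!compA.
  rewrite (reassoc (act_lunit _ _ _)).
  rewrite (reassoc (esym (bmapl _ _ _ _))) (reassoc (esym (bmapl _ _ _ _))).
  rewrite -compA E bmapl -compA -actA_natV.
  by rewrite -act_triangle -!compA bwdKr.
Defined.

Lemma iso_compE (k : fieldType) (E : lincat k) (x y z : E)
  (j : iso y z) (i : iso x y) : fwd (iso_comp j i) = fwd j ∘ fwd i.
Proof. by []. Qed.

Lemma runit_assoc (k : fieldType) (C : moncat k) (c d : C) :
  (idm c ⊠ runit d) ∘ assoc c d one = runit (c ⊗ d).
Proof. exact: (@mid_unit_r k C (regular_bimod C) c d). Qed.

Lemma lunit_assoc (k : fieldType) (C : moncat k) (c d : C) :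
  lunit (c ⊗ d) ∘ assoc one c d = lunit c ⊠ idm d.
Proof. exact: (act_lunit (regular_action C)). Qed.

Lemma lunit_runit_one (k : fieldType) (C : moncat k) :
  fwd (lunit (one : C)) = runit one.
Proof.
apply: (iso_injr (i := runit (one ⊗ one))).
rewrite -!runit_nat; congr (_ ∘ _).
rewrite -triangle -lunit_assoc; congr (_ ∘ _).
by apply: (iso_injl (i := lunit one)); rewrite lunit_nat.
Qed.

Section HalfBraidingAtOne.
Variables (k : fieldType) (C D : moncat k) (F : tensor_functor C D).
Variables (G : functor C D) (l : forall c x : C, iso (G (c ⊗ x)) (F c ⊗ G x)).
Variable r : forall x d : C, iso (G (x ⊗ d)) (G x ⊗ F d).
Hypothesis l_nat : forall c c' x x' (f : hom c c') (g : hom x x'),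
  l c' x' ∘ fmap G (f ⊠ g) = (fmap F f ⊠ fmap G g) ∘ l c x.
Hypothesis r_nat : forall x x' d d' (g : hom x x') (f : hom d d'),
  r x' d' ∘ fmap G (g ⊠ f) = (fmap G g ⊠ fmap F f) ∘ r x d.
Hypothesis l_assoc : forall c d x,
  assoc (F c) (F d) (G x) ∘ (bwd (tfM F c d) ⊠ idm (G x)) ∘ l (c ⊗ d) x =
  (idm (F c) ⊠ l d x) ∘ l c (d ⊗ x) ∘ fmap G (assoc c d x).
Hypothesis r_assoc : forall x c d,
  bwd (assoc (G x) (F c) (F d)) ∘ (idm (G x) ⊠ bwd (tfM F c d)) ∘ r x (c ⊗ d) =
  (r x c ⊠ idm (F d)) ∘ r (x ⊗ c) d ∘ fmap G (bwd (assoc x c d)).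
Hypothesis l_unit : forall x,
  lunit (G x) ∘ (bwd (tf1 F) ⊠ idm (G x)) ∘ l one x = fmap G (lunit x).
Hypothesis r_unit : forall x,
  runit (G x) ∘ (idm (G x) ⊠ bwd (tf1 F)) ∘ r x one = fmap G (runit x).
Hypothesis lr_mid : forall c x d,
  (idm (F c) ⊠ r x d) ∘ l c (x ⊗ d) ∘ fmap G (assoc c x d) =
  assoc (F c) (G x) (F d) ∘ (l c x ⊠ idm (F d)) ∘ r (c ⊗ x) d.

(* G c = G (c ⊗ 1) = F c ⊗ G 1 *)
Definition tr_l (c : C) : iso (G c) (F c ⊗ G one) :=
  iso_comp (l c one) (iso_fmap G (iso_inv (runit c))).

(* G c = G (1 ⊗ c) = G 1 ⊗ F c *)
Definition tr_r (c : C) : iso (G c) (G one ⊗ F c) :=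
  iso_comp (r one c) (iso_fmap G (iso_inv (lunit c))).

Lemma tr_l_nat (c c' : C) (f : hom c c') :
  tr_l c' ∘ fmap G f = (fmap F f ⊠ idm (G one)) ∘ tr_l c.
Proof.
rewrite /= -compA -fmapM.
have -> : bwd (runit c') ∘ f = (f ⊠ idm one) ∘ bwd (runit c).
  apply: (iso_injl (i := runit c')); rewrite bwdKr compA runit_nat -compA.
  by rewrite bwdK compm1.
by rewrite fmapM !compA l_nat fmap1.
Qed.

Lemma tr_r_nat (c c' : C) (f : hom c c') :
  tr_r c' ∘ fmap G f = (idm (G one) ⊠ fmap F f) ∘ tr_r c.
Proof.
rewrite /= -compA -fmapM.
have -> : bwd (lunit c') ∘ f = (idm one ⊠ f) ∘ bwd (lunit c).
  apply: (iso_injl (i := lunit c')); rewrite bwdKr compA lunit_nat -compA.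
  by rewrite bwdK compm1.
by rewrite fmapM !compA r_nat fmap1.
Qed.

Lemma tr_l_tens (c d : C) :
  (idm (F c) ⊠ tr_l d) ∘ l c d =
  assoc (F c) (F d) (G one)
    ∘ ((bwd (tfM F c d) ⊠ idm (G one)) ∘ tr_l (c ⊗ d)).
Proof.
have E : (idm c ⊠ bwd (runit d)) = assoc c d one ∘ bwd (runit (c ⊗ d)).
  apply: (iso_injl (i := iso_bmap tens (iso_id c) (runit d))) => /=.
  by rewrite compA runit_assoc bwdK -bmapM bwdK comp1m bmap1.
rewrite /= !compA l_assoc -!compA -fmapM -E l_nat fmap1.
by rewrite !compA -bmapM comp1m.
Qed.

Lemma tr_r_tens (c d : C) :
  (tr_r c ⊠ idm (F d)) ∘ r c d =
  bwd (assoc (G one) (F c) (F d))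
    ∘ ((idm (G one) ⊠ bwd (tfM F c d)) ∘ tr_r (c ⊗ d)).
Proof.
have E : (bwd (lunit c) ⊠ idm d) =
    bwd (assoc one c d) ∘ bwd (lunit (c ⊗ d)).
  apply: (iso_injl (i := iso_bmap tens (lunit c) (iso_id d))) => /=.
  by rewrite -[in RHS]lunit_assoc -!compA bwdKr bwdK -bmapM bwdK comp1m bmap1.
rewrite /= !compA r_assoc -!compA -fmapM -E r_nat fmap1.
by rewrite !compA -bmapM comp1m.
Qed.

Lemma tr_mid (c d : C) :
  assoc (F c) (G one) (F d) ∘ ((tr_l c ⊠ idm (F d)) ∘ r c d) =
  (idm (F c) ⊠ tr_r d) ∘ l c d.
Proof.
have E : (idm c ⊠ bwd (lunit d)) = assoc c one d ∘ (bwd (runit c) ⊠ idm d).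
  apply: (iso_injl (i := iso_bmap tens (iso_id c) (lunit d))) => /=.
  by rewrite compA triangle -!bmapM !bwdK !comp1m !bmap1.
have Nl := l_nat (idm c) (bwd (lunit d)); rewrite fmap1 in Nl.
have Nr := r_nat (bwd (runit c)) (idm d); rewrite fmap1 in Nr.
rewrite !iso_compE -{1}(comp1m (idm (F c))) bmapM -compA -Nl E fmapM !compA.
rewrite lr_mid -(comp1m (idm (F d))) bmapM -!compA comp1m.
by rewrite -Nr.
Qed.

Definition braid_at_one (c : C) : iso (G one ⊗ F c) (F c ⊗ G one) :=
  iso_comp (tr_l c) (iso_inv (tr_r c)).

Lemma braid_at_oneE (c : C) : fwd (braid_at_one c) ∘ fwd (tr_r c) = fwd (tr_l c).
Proof. by rewrite iso_compE -compA fwdK compm1. Qed.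

Lemma tf1_tr_l : (bwd (tf1 F) ⊠ idm (G one)) ∘ tr_l one = bwd (lunit (G one)).
Proof.
apply: (iso_injl (i := lunit (G one))); rewrite bwdK /= !compA l_unit.
by rewrite -fmapM lunit_runit_one bwdK fmap1.
Qed.

Lemma tf1_tr_r : (idm (G one) ⊠ bwd (tf1 F)) ∘ tr_r one = bwd (runit (G one)).
Proof.
apply: (iso_injl (i := runit (G one))); rewrite bwdK /= !compA r_unit.
by rewrite -fmapM -lunit_runit_one bwdK fmap1.
Qed.

Definition half_braiding_at_one : half_braiding F (G one).
Proof.
apply: (@HalfBraiding k C D F (G one) braid_at_one).
- move: braid_at_oneE tr_l_nat tr_r_nat.
  move: braid_at_one tr_l tr_r => s L R sE Ln Rn c c' f.
  by apply: (iso_injr (i := R c)); rewrite -compA -Rn compA sE Ln -compA sE.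
- move: braid_at_oneE tr_l_tens tr_r_tens tr_mid.
  move: braid_at_one tr_l tr_r => s L R sE Lt Rt LR c d.
  apply: (iso_injr (i := assoc (G one) (F c) (F d))).
  apply: (iso_injr (i := iso_bmap tens (R c) (iso_id (F d)))).
  apply: (iso_injr (i := r c d)); rewrite /= -!compA fwdKr [in LHS]Rt.
  rewrite bwdKr (reassoc (esym (bmapM _ _ _ _ _))) bwdK comp1m bmap1 comp1m.
  rewrite sE [in RHS](reassoc (esym (bmapM _ _ _ _ _))) comp1m sE LR.
  rewrite (reassoc (esym (bmapM _ _ _ _ _))) comp1m sE Lt fwdKr.
  by rewrite (reassoc (esym (bmapM _ _ _ _ _))) bwdK comp1m bmap1 comp1m.
- move: braid_at_oneE tf1_tr_l tf1_tr_r.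
  move: braid_at_one tr_l tr_r => s L R sE L1 R1.
  apply: (iso_injr (i := iso_bmap tens (iso_id (G one)) (iso_inv (tf1 F)))).
  apply: (iso_injr (i := R one)); rewrite /= -!compA.
  rewrite (reassoc (esym (bmapM _ _ _ _ _))) bwdK comp1m bmap1 comp1m.
  rewrite sE R1 bwdK compm1 -L1.
  by rewrite (reassoc (esym (bmapM _ _ _ _ _))) bwdK comp1m bmap1 comp1m.
Defined.

End HalfBraidingAtOne.

(* The half-braiding G 1 ⊗ F c = G c = F c ⊗ G 1 of a C-bimodule functor G from
   C to D restricted along F. *)
Definition bimodfun_half_braiding (k : fieldType) (C D : moncat k)
  (F : tensor_functor C D)
  (G : bimodfun (regular_bimod C) (res_bimod F (regular_bimod D))) :
  half_braiding F (G one).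
Proof.
apply: (@half_braiding_at_one k C D F G (fun c x => bf_l G c x)
  (fun x d => bf_r G d x)).
- exact: (ms_nat (bf_l G)).
- by move=> x x' d d' g f; apply: (ms_nat (bf_r G) f g).
- move=> c d x; have := ms_assoc (bf_l G) c d x.
  by rewrite /= fmap1.
- move=> x c d; have := ms_assoc (bf_r G) d c x.
  by rewrite /= fmap1.
- move=> x; have := ms_unit (bf_l G) x; exact.
- move=> x; have := ms_unit (bf_r G) x; exact.
- move=> c x d; have := bf_mid G c x d.
  by rewrite /= !fmap1.
Defined.

Section Frobenius.
Variables (k : fieldType) (C D : fin_tensor_cat k) (F : tensor_functor C D).

Local Notation Cbim := (regular_bimod C).
Local Notation Dbim := (res_bimod F (regular_bimod D)).

(* Adjoints, also as bimodule functors, are unique up to a unique isomorphism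
   compatible with all structure: the notions below do not depend on the choice
   of the adjoints. *)

Definition perfect :=
  exists (Fra : functor D C) (_ : adjunction F Fra), exact_functor Fra.

Definition frobenius :=
  exists (Fla Fra : functor D C) (_ : adjunction Fla F) (_ : adjunction F Fra),
    inhabited (natiso Fla Fra).

Definition tensor_frobenius :=
  exists (Fla Fra : bimodfun Dbim Cbim)
    (_ : bimod_adjunction Fla (tf_bimodfun F))
    (_ : bimod_adjunction (tf_bimodfun F) Fra),
    bimod_isomorphic Fla Fra.

(* The relative modular object Frra 1, with its half-braiding, acts on M as the
   identity. *)
Definition frobenius_wrt (M : modcat D) :=
  exists (Fra : bimodfun Dbim Cbim) (Frra : bimodfun Cbim Dbim)
    (_ : bimod_adjunction (tf_bimodfun F) Fra)
    (_ : bimod_adjunction Fra Frra),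
    mod_isomorphic (hb_modstr (bimodfun_half_braiding Frra) (mc_act M))
      (id_modstr (res_action F (mc_act M))).

End Frobenius.

(* Main.v *)
From mathcomp Require Import ssreflect ssrfun.
Require Import Defs.
From mathcomp Require Import ssralg.

Set Implicit Arguments.
Unset Strict Implicit.
Unset Printing Implicit Defensive.

Local Open Scope cat_scope.

(** Adjoints are unique, so an isomorphism [Fla ≅ Fra] of bimodule functors
    makes [F] itself a choice of [Frra], whose relative modular object is
    [F 1 ≅ 1] with the half-braiding coming from the unit constraints; it acts
    on every module category as the identity. Conversely, [Frra c ≅ χ ⊗ F c]
    naturally in [c], so if [χ] acts trivially on [D] then [Frra ≅ F], and
    [Fra] is a left adjoint of [F] as well as a right one. *)

Section TransportedAdjunction.
Variable k : fieldType.

Lemma natiso_natV (C D : lincat k) (G H : functor C D) (t : natiso G H)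
  (x y : C) (f : hom x y) : bwd (t y) ∘ fmap H f = fmap G f ∘ bwd (t x).
Proof.
apply: (iso_injl (i := t y)); rewrite bwdKr compA nt_nat -compA.
by rewrite bwdK compm1.
Qed.

Variables (M N : lincat k).

Definition natiso_id (G : functor M N) : natiso G G.
Proof.
by exists (fun x => iso_id (G x)) => x y f; rewrite /= comp1m compm1.
Defined.

Definition adjunction_natiso_l (L L' : functor M N) (R : functor N M)
  (t : natiso L L') (A : adjunction L R) : adjunction L' R.
Proof.
apply: (@Adjunction k M N L' R (fun x => fmap R (t x) ∘ adj_unit A x)
  (fun y => adj_counit A y ∘ bwd (t (R y)))).
- move=> x x' f; rewrite -!compA adj_unit_nat !compA -!fmapM.
  by rewrite nt_nat.
- move=> y y' f; rewrite -!compA natiso_natV !compA.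
  by rewrite adj_counit_nat.
(* Precomposing with [t x] lets naturality cancel [t] against its inverse, leaving the triangle of
   [A]. *)
- move=> x; apply: (iso_injr (i := t x)).
  rewrite -!compA -nt_nat fwdKr fmapM (reassoc (adj_counit_nat A _)).
  by rewrite -compA adj_triangle_l comp1m compm1.
- move=> y; rewrite compA -fmapM -compA fwdK compm1.
  exact: adj_triangle_r.
Defined.

Definition adjunction_natiso_r (L : functor M N) (R R' : functor N M)
  (t : natiso R R') (A : adjunction L R) : adjunction L R'.
Proof.
apply: (@Adjunction k M N L R' (fun x => t (L x) ∘ adj_unit A x)
  (fun y => adj_counit A y ∘ fmap L (bwd (t y)))).
- move=> x x' f; rewrite -!compA adj_unit_nat !compA.
  by rewrite nt_nat.
- move=> y y' f; rewrite -!compA -fmapM natiso_natV fmapM.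
  by rewrite (reassoc (adj_counit_nat A f)) -!compA.
- move=> x; rewrite -compA -fmapM fwdKr.
  exact: adj_triangle_l.
- move=> y; apply: (iso_injl (i := iso_inv (t y))) => /=.
  rewrite compm1 !compA natiso_natV fmapM -!compA fwdKr.
  by rewrite -adj_unit_nat compA adj_triangle_r comp1m.
Defined.

Variables (C : moncat k) (aM : action C M) (aN : action C N).

(** The new unit ends with [R t] and the new counit starts with the inverse of [t]. As [t] respects
    the actions, it slides past the constraints, which reduces both conditions to those for [A]. For
    bimodule functors this serves once per side. *)
Lemma is_modadj_natiso_l (L L' : functor M N) (R : functor N M)
  (sL : modstr aM aN L) (sL' : modstr aM aN L') (sR : modstr aN aM R)
  (t : natiso L L') (A : adjunction L R) :
  is_modtrans sL sL' (fun m => t m) -> is_modadj sL sR A ->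
  is_modadj sL' sR (adjunction_natiso_l t A).
Proof.
move=> tmod [Aunit Acounit]; split=> [c m|c n] /=.
- rewrite -!compA (reassoc (esym (fmapM R _ _))) tmod fmapM -!compA.
  rewrite (reassoc (ms_nat sR (idm c) (t m))) -!compA.
  by rewrite (compA (sR c (L m))) Aunit -bmapr.
- apply: (iso_injr (i := t (R (aN c n)))).
  rewrite -!compA -nt_nat (reassoc (tmod c (R n))) fwdK compm1.
  rewrite bmapr -!compA (reassoc (esym (bmapr _ _ (bwd _) (fwd _)))).
  by rewrite fwdK bmap1 comp1m compA Acounit.
Qed.

End TransportedAdjunction.

Section RelativeModularObject.
Variables (k : fieldType) (C D : moncat k) (F : tensor_functor C D).

Local Notation σ := (bimodfun_half_braiding (tf_bimodfun F)).

(** Both sides become the identity of [F c] after precomposition with [tr_r], by the unit axioms of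
    [F]. Thus [σ] is the trivial half-braiding of the unit object, transported along [tf1 F]. *)
Lemma tf_half_braidingE (c : C) :
  runit (F c) ∘ (idm (F c) ⊠ bwd (tf1 F)) ∘ σ c =
  lunit (F c) ∘ (bwd (tf1 F) ⊠ idm (F c)).
Proof.
apply: (iso_injr (i := iso_comp (iso_inv (tfM F one c))
  (iso_fmap F (iso_inv (lunit c))))).
rewrite /= -!compA bwdKr -(fmapM F (lunit c)) bwdK fmap1 compm1.
have := tf_runitV F c; have := tf_lunitV F c; rewrite !compA => -> ->.
by rewrite -!fmapM !bwdK.
Qed.

Variables (M : lincat k) (a : action D M).

Definition tf_one_act : natiso (bifix_l a (F one)) (id_functor M).
Proof.
exists (fun m => iso_comp (act1 a m)
  (iso_bmap a (iso_inv (tf1 F)) (iso_id m))) => m m' f /=.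
by rewrite -compA bmap_swap !compA act1_nat.
Defined.

(** Naturality of [actA] and the triangle axiom gather the side containing [σ] into the action of
    one morphism of [D], which [tf_half_braidingE] rewrites; the left unit triangle [act_lunit] then
    gives the other side. *)
Lemma tf_one_act_modtrans :
  is_modtrans (hb_modstr σ a) (id_modstr (res_action F a))
    (fun m => tf_one_act m).
Proof.
move=> c m; rewrite [LHS]comp1m.
change (act1 a (a (F c) m) ∘ bmap a (bwd (tf1 F)) (idm (a (F c) m)) =
  bmap a (fmap F (idm c)) (act1 a m ∘ bmap a (bwd (tf1 F)) (idm m))
  ∘ (actA a (F c) (F one) m
     ∘ (bmap a (σ c) (idm m) ∘ bwd (actA a (F one) (F c) m)))).
rewrite fmap1 bmapr -!compA (reassoc (esym (actA_nat a _ _ _))) -!compA.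
rewrite (reassoc (act_triangle a _ _)) !compA -!bmapl tf_half_braidingE.
apply: (iso_injr (i := actA a (F one) (F c) m)).
rewrite -[RHS]compA fwdK compm1 bmapl -act_lunit -!compA -(bmap1 a (F c) m).
by rewrite actA_nat bmap1.
Qed.

End RelativeModularObject.

Theorem proposition4p18 (k : closedFieldType) (C D : fin_tensor_cat k)
    (F : tensor_functor C D) (F_perfect : perfect F) :
  (tensor_frobenius F -> forall M : modcat D, frobenius_wrt F M) /\
  (frobenius_wrt F (regular_modcat D) -> frobenius F).
Proof.
split=> [[Fla [Fra [Ala [Ara [t [tl tr]]]]]] M|[Fra [Frra [Ara [Arra [t _]]]]]].
- have B : bimod_adjunction Fra (tf_bimodfun F).
    exists (adjunction_natiso_l t Ala).
    + exact: is_modadj_natiso_l tl (ba_l Ala).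
    + exact: is_modadj_natiso_l tr (ba_r Ala).
  (* With [F] in the place of [Frra], the relative modular object is [F one]. *)
  exists Fra, (tf_bimodfun F), Ara, B, (tf_one_act F (mc_act M)).
  exact: tf_one_act_modtrans.
(* The right structure is a left one over the reversed category, so [bf_r] takes the acting object
   first; [r] restores the order that [tr_r] expects. *)
- pose r x d : iso (Frra (x ⊗ d)) (Frra x ⊗ F d) := bf_r Frra d x.
  have r_nat x x' d d' (g : hom x x') (h : hom d d') :
      r x' d' ∘ fmap Frra (g ⊠ h) = (fmap Frra g ⊠ fmap F h) ∘ r x d.
    exact: (ms_nat (bf_r Frra) h g).
  have u : natiso Frra F.
    (* In the regular module category [Frra one] acts by tensoring on the left, so [t] at [F c]
       removes it from [Frra one ⊗ F c]. *)
    exists (fun c => iso_comp (t (F c)) (tr_r r c)) => c c' f.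
    rewrite !iso_compE -compA [X in _ ∘ X](tr_r_nat r_nat f) !compA.
    by do 2![congr (_ ∘ _)]; apply: (nt_nat t (fmap F f)).
  (* Through [u], [Fra] is adjoint to [F] on both sides, so the identity compares the two
     adjoints. *)
  exists Fra, Fra, (adjunction_natiso_r u Arra), Ara.
  exact: (inhabits (natiso_id Fra)).
Qed.
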